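(* The natural action of the group $O(N)$, correspondingly $SO(N)$, on the set $\mathfrak{F}_r(N)$ of all orthogonal partial flags of length $r$ given by $(g,\{V_j\}_{j=1}^r)\mapsto\{gV_j\}_{j=1}^r$ corresponds to the action by conjugation $(g,H)\mapsto gHg^{-1}$ on the set of maximal orthogonal Borel subgroups, respectively maximal connected orthogonal Borel subgroups, associated with these flags. That is, if $H$ is the maximal orthogonal (respectively maximal connected orthogonal) Borel subgroup associated with $\{V_j\}_{j=1}^r$, then the one associated with $\{gV_j\}_{j=1}^r$ is $gHg^{-1}$, for every $g\in O(N)$ (respectively $g\in SO(N)$).
   Context: An orthogonal partial flag of length $r$ in $\mathbb{R}^N$ is an orthogonal decomposition $\mathbb{R}^N=\bigoplus_{j=1}^r V_j$ into nonzero subspaces. The maximal orthogonal Borel subgroup associated with $\{V_1,\dots,V_r\}$ is $O(V_1)\times\dots\times O(V_r)\subset O(N)$, and the maximal connected orthogonal Borel subgroup is $SO(V_1)\times\dots\times SO(V_r)\subset SO(N)$, acting blockwise on $\mathbb{R}^N=\bigoplus V_j$. *)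

(* Defs.v *)
From mathcomp Require Import all_boot all_order all_fingroup all_algebra.
From mathcomp Require Import all_classical all_reals.

Set Implicit Arguments.
Unset Strict Implicit.
Unset Printing Implicit Defensive.

Import GRing.Theory.
Local Open Scope ring_scope.
Local Open Scope classical_set_scope.

Section OrthogonalFlags.
Variables (R : realType) (N : nat).
Implicit Types (U : {vspace 'cV[R]_N}) (g h : 'M[R]_N) (H : set 'M[R]_N).

Definition dotc (u v : 'cV[R]_N) : R := (u^T *m v) 0 0.

Definition orthogonal_group : set 'M[R]_N := [set g | g^T *m g = 1%:M].

Definition special_orthogonal_group : set 'M[R]_N :=
  [set g | orthogonal_group g /\ \det g = 1].

(* The determinant of an endomorphism is that of its matrix in a basis. *)
Definition det_end (vT : vectType R) (f : 'End(vT)) : R :=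
  \det (passmx.mxof (vbasis {:vT}) (vbasis {:vT}) f).

Definition orthogonal_on U : set 'End(subvs_of U) :=
  [set f | forall u v, dotc (vsval (f u)) (vsval (f v))
                       = dotc (vsval u) (vsval v)].

Definition special_orthogonal_on U : set 'End(subvs_of U) :=
  [set f | orthogonal_on f /\ det_end f = 1].

(* Flags are indexed families of subspaces; by max_orth_borel_perm and
   max_conn_orth_borel_perm below, the associated groups only depend on the
   underlying unordered collection {V_1, ..., V_r}. *)
Definition orthogonal_flag r (V : 'I_r -> {vspace 'cV[R]_N}) : Prop :=
  [/\ forall j, V j != 0%VS,
      forall i j, i != j ->
        forall u v, u \in V i -> v \in V j -> dotc u v = 0,
      directv (\sum_(j < r) V j)%VS
    & (\sum_(j < r) V j)%VS = fullv].

Definition orthogonal_flags r : set ('I_r -> {vspace 'cV[R]_N}) :=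
  [set V | orthogonal_flag V].

Definition flag_act r g (V : 'I_r -> {vspace 'cV[R]_N}) :
    'I_r -> {vspace 'cV[R]_N} :=
  fun j => (linfun (mulmx g : 'cV[R]_N -> 'cV[R]_N) @: V j)%VS.

(* The product of the groups G (V j), embedded blockwise in the matrices:
   the matrix h of a tuple (f_j) acts as f_j on V j. *)
Definition block_product (G : forall U, set 'End(subvs_of U))
    r (V : 'I_r -> {vspace 'cV[R]_N}) : set 'M[R]_N :=
  [set h | exists f : forall j, 'End(subvs_of (V j)),
     (forall j, G (V j) (f j)) /\
     (forall j (v : subvs_of (V j)), h *m vsval v = vsval (f j v))].

Definition max_orth_borel r (V : 'I_r -> {vspace 'cV[R]_N}) : set 'M[R]_N :=
  block_product orthogonal_on V.

Definition max_conn_orth_borel r (V : 'I_r -> {vspace 'cV[R]_N}) :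
    set 'M[R]_N :=
  block_product special_orthogonal_on V.

Definition max_orth_borels r : set (set 'M[R]_N) :=
  [set max_orth_borel V | V in @orthogonal_flags r].

Definition max_conn_orth_borels r : set (set 'M[R]_N) :=
  [set max_conn_orth_borel V | V in @orthogonal_flags r].

Definition conj_act g H : set 'M[R]_N := [set g *m h *m invmx g | h in H].

(* act is a left action of the matrix group G on the set X. *)
Definition group_action (G : set 'M[R]_N) (T : Type) (X : set T)
    (act : 'M[R]_N -> T -> T) : Prop :=
  [/\ forall g x, G g -> X x -> X (act g x),
      forall x, X x -> act 1%:M x = x
    & forall g h x, G g -> G h -> X x -> act (g *m h) x = act g (act h x)].

Lemma block_product_perm (G : forall U, set 'End(subvs_of U)) r
    (V : 'I_r -> {vspace 'cV[R]_N}) (s : 'S_r) :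
  block_product G (V \o s) = block_product G V.
Proof.
have sub W (t : 'S_r) : block_product G W `<=` block_product G (W \o t).
  by move=> h [f [Gf hf]]; exists (fun j => f (t j)); split=> j /=.
apply/seteqP; split; last exact: sub.
have {2}-> : V = (V \o s) \o (s^-1)%g by apply/funext => j /=; rewrite permKV.
exact: sub.
Qed.

Lemma max_orth_borel_perm r (V : 'I_r -> {vspace 'cV[R]_N}) (s : 'S_r) :
  max_orth_borel (V \o s) = max_orth_borel V.
Proof. exact: block_product_perm. Qed.

Lemma max_conn_orth_borel_perm r (V : 'I_r -> {vspace 'cV[R]_N}) (s : 'S_r) :
  max_conn_orth_borel (V \o s) = max_conn_orth_borel V.
Proof. exact: block_product_perm. Qed.

End OrthogonalFlags.

Arguments orthogonal_group R N : clear implicits.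
Arguments special_orthogonal_group R N : clear implicits.
Arguments orthogonal_flags R N r : clear implicits.
Arguments max_orth_borels R N r : clear implicits.
Arguments max_conn_orth_borels R N r : clear implicits.

(* Main.v *)
Require Import Defs.
From mathcomp Require Import all_boot all_order all_fingroup all_algebra.
From mathcomp Require Import all_classical all_reals.

(** The left multiplication by [g] restricts to an isometry from [V j] onto
    [g V j]; conjugation by it carries an isometry of [V j], of the same
    determinant, to the block on [g V j] of the conjugate matrix. Hence
    conjugation by [g] maps the group of a flag into that of its translate,
    and equality follows by applying this to [g^-1]. *)

Set Implicit Arguments.
Unset Strict Implicit.
Unset Printing Implicit Defensive.

Import GRing.Theory.
Local Open Scope ring_scope.
Local Open Scope classical_set_scope.

(** The sizes [m] and [n] are a priori distinct, as they will be dimensions of two different spaces;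
    the two inverse relations force them to agree. *)
Lemma det_mxsim (K : fieldType) m n (A : 'M[K]_(m, n)) (B : 'M[K]_(n, m))
    (M : 'M[K]_m) :
  A *m B = 1%:M -> B *m A = 1%:M -> \det (B *m M *m A) = \det M.
Proof.
move=> AB BA; have mn : m = n.
  apply/eqP; rewrite eqn_leq; apply/andP; split.
    by move/mulmx1_min: AB.
  by move/mulmx1_min: BA.
case: n / mn A B AB BA => A B AB BA.
by rewrite !det_mulmx mulrAC -det_mulmx BA det1 mul1r.
Qed.

(** The matrices of [phi] and [psi] in the chosen bases are mutually inverse, so the two
    determinants are those of similar matrices. *)
Lemma det_end_conj (R : realType) (uT vT : vectType R) (phi : 'Hom(uT, vT))
    (psi : 'Hom(vT, uT)) (f : 'End(uT)) :
  (psi \o phi = \1)%VF -> (phi \o psi = \1)%VF ->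
  det_end (phi \o f \o psi)%VF = det_end f.
Proof.
move=> psiK phiK; have eu := vbasisP {:uT}; have ev := vbasisP {:vT}.
(* Matrices of linear maps act on row vectors, so composition reverses the order of the factors. *)
rewrite /det_end (passmx.mxof_comp _ _ eu) (passmx.mxof_comp _ _ eu) mulmxA.
apply: det_mxsim.
  by rewrite -(passmx.mxof_comp _ _ ev) psiK passmx.mxof1 ?(basis_free eu).
by rewrite -(passmx.mxof_comp _ _ eu) phiK passmx.mxof1 ?(basis_free ev).
Qed.

Section OrthogonalAction.
Variables (R : realType) (N r : nat).
Implicit Types (g h : 'M[R]_N) (U W : {vspace 'cV[R]_N}).
Implicit Types V : 'I_r -> {vspace 'cV[R]_N}.

Local Notation mulfun g := (linfun (mulmx g : 'cV[R]_N -> 'cV[R]_N)).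

(** The one property of the blocks used below, isolated to treat the orthogonal and special
    orthogonal cases together. The inverse [psi] is explicit since [phi] relates two different
    types. *)
Definition isometry_invariant (G : forall U, set 'End(subvs_of U)) : Prop :=
  forall U W (phi : 'Hom(subvs_of U, subvs_of W))
    (psi : 'Hom(subvs_of W, subvs_of U)) f,
  (psi \o phi = \1)%VF -> (phi \o psi = \1)%VF ->
  (forall u v, dotc (vsval (phi u)) (vsval (phi v))
               = dotc (vsval u) (vsval v)) ->
  G U f -> G W (phi \o f \o psi)%VF.

Lemma orthogonal_on_invariant : isometry_invariant (@orthogonal_on R N).
Proof.
move=> U W phi psi f _ phiK iso isof u v.
(* After [phi] and [f] are removed, [phi] is reinserted in front of [psi], where it cancels. *)
by rewrite !comp_lfunE /= iso isof -iso -!comp_lfunE phiK !id_lfunE.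
Qed.

Lemma special_orthogonal_on_invariant :
  isometry_invariant (@special_orthogonal_on R N).
Proof.
move=> U W phi psi f psiK phiK iso [isof detf]; split.
  exact: orthogonal_on_invariant.
by rewrite det_end_conj.
Qed.

Lemma orthogonal_unitmx g : orthogonal_group R N g -> g \in unitmx.
Proof. by move=> /mulmx1_unit[]. Qed.

Lemma orthogonal_invmx g :
  orthogonal_group R N g -> orthogonal_group R N (invmx g).
Proof.
move=> Og; have gU := orthogonal_unitmx Og.
have -> : invmx g = g^T by rewrite -[LHS]mul1mx -Og mulmxK.
by rewrite /orthogonal_group /= trmxK; apply: mulmx1C.
Qed.

Lemma dotc_orthogonal g u v :
  orthogonal_group R N g -> dotc (g *m u) (g *m v) = dotc u v.
Proof. by move=> Og; rewrite /dotc trmx_mul mulmxA -(mulmxA u^T) Og mulmx1. Qed.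

Lemma mem_flag_act g V j u : u \in V j -> g *m u \in flag_act g V j.
Proof. by move=> uV; rewrite -[g *m u](lfunE (mulmx g)) memv_img. Qed.

Lemma flag_act1 V : flag_act 1%:M V = V.
Proof.
apply/funext => j; rewrite /flag_act -[RHS]lim1g; congr (_ @: _)%VS.
by apply/lfunP => u; rewrite !lfunE /= mul1mx.
Qed.

Lemma flag_actM g h V : flag_act (g *m h) V = flag_act g (flag_act h V).
Proof.
apply/funext => j; rewrite /flag_act -limg_comp; congr (_ @: _)%VS.
by apply/lfunP => u; rewrite !lfunE /= !lfunE /= mulmxA.
Qed.

Lemma flag_actK g V : g \in unitmx -> flag_act (invmx g) (flag_act g V) = V.
Proof. by move=> gU; rewrite -flag_actM mulVmx ?flag_act1. Qed.

Lemma mem_flag_act_invmx g V j w :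
  g \in unitmx -> w \in flag_act g V j -> invmx g *m w \in V j.
Proof.
by move=> gU /(mem_flag_act (invmx g)); rewrite (flag_actK V gU).
Qed.

Lemma lker_mulfun g : g \in unitmx -> lker (mulfun g) == 0%VS.
Proof.
move=> gU; apply/lker0P => u v; rewrite !lfunE /=.
exact: (can_inj (mulKmx gU)).
Qed.

Lemma flag_act_flag g V :
  orthogonal_group R N g -> orthogonal_flag V ->
  orthogonal_flag (flag_act g V).
Proof.
move=> Og [V0 Vorth Vdir Vfull]; have gU := orthogonal_unitmx Og.
have kg := lker_mulfun gU.
have dimg U : \dim (mulfun g @: U) = \dim U.
  by rewrite limg_dim_eq // (eqP kg) capv0.
split.
- by move=> j; rewrite -dimv_eq0 dimg dimv_eq0.
(* Orthogonality is pulled back to [V] along [invmx g], itself an isometry. *)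
- move=> i j ij u v /(mem_flag_act_invmx gU) uV /(mem_flag_act_invmx gU) vV.
  rewrite -(Vorth i j ij _ _ uV vV) dotc_orthogonal //.
  exact: orthogonal_invmx.
(* Directness says that the dimension of the sum is the sum of the dimensions, and [g] preserves
   dimensions. *)
- move/directvP: Vdir => /= Vdir; apply/directvP => /=.
  rewrite -limg_sum dimg Vdir.
  by apply: eq_bigr => j _; rewrite dimg.
- by rewrite -limg_sum Vfull lker0_limgf.
Qed.

Lemma conj_act1 (H : set 'M[R]_N) : conj_act 1%:M H = H.
Proof.
by rewrite /conj_act (eq_imagel (f' := id)) ?image_id // => h _;
  rewrite invmx1 mulmx1 mul1mx.
Qed.

(** Inversion reverses products of invertible matrices; this can fail for singular ones, which
    [invmx] leaves unchanged. *)
Lemma conj_actM g h (H : set 'M[R]_N) : g \in unitmx -> h \in unitmx ->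
  conj_act (g *m h) H = conj_act g (conj_act h H).
Proof.
move=> gU hU; rewrite /conj_act image_comp; apply: eq_imagel => x _ /=.
have -> : invmx (g *m h) = invmx h *m invmx g.
  have ghU : g *m h \in unitmx by rewrite unitmx_mul gU.
  by apply: (can_inj (mulKmx ghU)); rewrite mulmxV // mulmxA mulmxK // mulmxV.
by rewrite !mulmxA.
Qed.

Section BlockProduct.
Variable G : forall U, set 'End(subvs_of U).
Hypothesis G_inv : isometry_invariant G.

Lemma conj_act_block_product_sub g V : orthogonal_group R N g ->
  conj_act g (block_product G V) `<=` block_product G (flag_act g V).
Proof.
move=> Og _ [h [f [Gf hf]] <-]; have gU := orthogonal_unitmx Og.
(* The restrictions of [g] and [invmx g] to the blocks; [vsproj] only retypes the result, which
   already lies in the target subspace. *)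
pose phi j : 'Hom(subvs_of (V j), subvs_of (flag_act g V j)) :=
  linfun (vsproj (flag_act g V j) \o mulmx g \o vsval).
pose psi j : 'Hom(subvs_of (flag_act g V j), subvs_of (V j)) :=
  linfun (vsproj (V j) \o mulmx (invmx g) \o vsval).
have phiE j u : vsval (phi j u) = g *m vsval u.
  by rewrite lfunE /= vsprojK // mem_flag_act // subvsP.
have psiE j w : vsval (psi j w) = invmx g *m vsval w.
  by rewrite lfunE /= vsprojK // mem_flag_act_invmx // subvsP.
exists (fun j => phi j \o f j \o psi j)%VF; split=> [j | j w].
  apply: G_inv => //.
  - apply/lfunP => u; apply: subvs_inj.
    by rewrite comp_lfunE psiE phiE id_lfunE mulKmx.
  - apply/lfunP => u; apply: subvs_inj.
    by rewrite comp_lfunE phiE psiE id_lfunE mulKVmx.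
  - by move=> u v; rewrite !phiE dotc_orthogonal.
by rewrite !comp_lfunE phiE -hf psiE !mulmxA.
Qed.

Lemma block_product_flag_act g V : orthogonal_group R N g ->
  block_product G (flag_act g V) = conj_act g (block_product G V).
Proof.
move=> Og; apply/seteqP; split; last exact: conj_act_block_product_sub.
have gU := orthogonal_unitmx Og; have Og' := orthogonal_invmx Og.
(* Writing [V] as the translate of [flag_act g V] by [invmx g], and the left side as its conjugate
   by [g *m invmx g], leaves the inclusion already proved, for [invmx g], under conjugation by
   [g]. *)
rewrite -{2}(flag_actK V gU) -[X in X `<=` _]conj_act1 -(mulmxV gU).
rewrite conj_actM ?unitmx_inv //.
by apply: image_subset; apply: conj_act_block_product_sub.
Qed.

End BlockProduct.

Section Subgroup.
Variable K : set 'M[R]_N.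
Hypothesis K_orth : K `<=` orthogonal_group R N.

Lemma flag_act_group_action :
  group_action K (orthogonal_flags R N r) (@flag_act R N r).
Proof.
split=> [g V /K_orth Og | V _ | g h V _ _ _].
- exact: flag_act_flag.
- exact: flag_act1.
- exact: flag_actM.
Qed.

(** Stability holds because the conjugate by [g] of the group of [V] is the group of the flag
    [flag_act g V]. *)
Lemma conj_act_group_action (G : forall U, set 'End(subvs_of U)) :
  isometry_invariant G ->
  group_action K [set block_product G V | V in orthogonal_flags R N r]
    (@conj_act R N).
Proof.
move=> G_inv; split=> [g _ /K_orth Og [V Vflag <-] | H _ | g h H Kg Kh _].
- exists (flag_act g V); first exact: flag_act_flag.
  exact: block_product_flag_act.
- exact: conj_act1.
- by apply: conj_actM; apply: orthogonal_unitmx; apply: K_orth.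
Qed.

End Subgroup.

End OrthogonalAction.

Theorem proposition3p2 (R : realType) (N r : nat) :
  [/\ group_action (orthogonal_group R N)
        (orthogonal_flags R N r) (@flag_act R N r),
      group_action (orthogonal_group R N)
        (max_orth_borels R N r) (@conj_act R N)
    & forall (g : 'M[R]_N) (V : 'I_r -> {vspace 'cV[R]_N}),
        orthogonal_group R N g -> orthogonal_flag V ->
        max_orth_borel (flag_act g V) = conj_act g (max_orth_borel V)]
  /\
  [/\ group_action (special_orthogonal_group R N)
        (orthogonal_flags R N r) (@flag_act R N r),
      group_action (special_orthogonal_group R N)
        (max_conn_orth_borels R N r) (@conj_act R N)
    & forall (g : 'M[R]_N) (V : 'I_r -> {vspace 'cV[R]_N}),
        special_orthogonal_group R N g -> orthogonal_flag V ->
        max_conn_orth_borel (flag_act g V)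
          = conj_act g (max_conn_orth_borel V)].
Proof.
have SO_O : special_orthogonal_group R N `<=` orthogonal_group R N.
  by move=> g [].
have O_inv := @orthogonal_on_invariant R N.
have SO_inv := @special_orthogonal_on_invariant R N.
split; split.
- exact: flag_act_group_action.
- exact: conj_act_group_action.
- by move=> g V Og _; apply: block_product_flag_act.
- exact: flag_act_group_action.
- exact: conj_act_group_action.
- by move=> g V /SO_O Og _; apply: block_product_flag_act.
Qed.
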